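(* Let $n\ge 10$. The graph $G(5,n)$ is bipartite with partite sets $X=\{v\equiv 0\pmod 4\}$ and $Y=\{v\equiv 2\pmod 4\}$, and its vertex set can be partitioned into an independent set $I$ and two sets inducing paths $Q_1$ and $Q_2$ such that every vertex of $Q_1$ is adjacent to all vertices of $I$ and all vertices of $Q_2$ lying in the partite set opposite to it, and every vertex of $Q_2$ is adjacent to all vertices of $I$ and all vertices of $Q_1$ lying in the partite set opposite to it; these together with the edges of $Q_1$ and $Q_2$ are all the edges of $G(5,n)$. Moreover, $G(5,1)\cong K_1$, $G(5,2)\cong K_2$, $G(5,3)\cong P_3$, $G(5,4)\cong C_4$, $G(5,5)\cong K_{2,3}$, $G(5,6)\cong K_{3,3}$, $G(5,7)\cong K_{3,4}$, $G(5,8)$ is obtained from $K_{4,4}$ by deleting exactly one edge, and $G(5,9)$ is obtained from $K_{4,5}$ by deleting two disjoint edges.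
   Context: For a prime $p$ and $n\in\mathbb{N}$, $G(p,n)$ is the simple graph with vertex set $\{2,4,\ldots,2n\}$ in which two distinct vertices $a,b$ are adjacent if and only if both $\frac{a+b}{2}$ and $\frac{|a-b|}{2}$ are odd positive integers neither of which equals $pk$ for an integer $k\ge 2$. $P_k$ is the path on $k$ vertices, $C_k$ the cycle on $k$ vertices, $K_{r,s}$ the complete bipartite graph. *)

(* Defs.v *)
From HB Require Import structures.
From mathcomp Require Import all_boot all_order ssralg ssrint.

Set Implicit Arguments.
Unset Strict Implicit.
Unset Printing Implicit Defensive.

Record sgraph := SGraph {
  svertex :> finType;
  adj : rel svertex;
  adj_sym : symmetric adj;
  adj_irr : irreflexive adj }.

Definition graph_iso (G H : sgraph) : Prop :=
  exists f : G -> H, bijective f /\ forall x y, adj (f x) (f y) = adj x y.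

Definition edge_set (G : sgraph) : {set {set G}} :=
  [set e | [exists x : G, exists y : G, adj x y && (e == [set x; y])]].

Section InducedDeleted.
Variable G : sgraph.

Definition induced_adj (S : {set G}) : rel {x : G | x \in S} :=
  fun x y => adj (val x) (val y).

Fact induced_sym S : symmetric (@induced_adj S).
Proof. by move=> x y; exact: adj_sym. Qed.

Fact induced_irr S : irreflexive (@induced_adj S).
Proof. by move=> x; exact: adj_irr. Qed.

Definition induced (S : {set G}) : sgraph :=
  SGraph (@induced_sym S) (@induced_irr S).

Definition del_adj (F : {set {set G}}) : rel G :=
  fun x y => adj x y && ([set x; y] \notin F).

Fact del_sym F : symmetric (del_adj F).
Proof. by move=> x y; rewrite /del_adj adj_sym setUC. Qed.

Fact del_irr F : irreflexive (del_adj F).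
Proof. by move=> x; rewrite /del_adj adj_irr. Qed.

Definition del_edges (F : {set {set G}}) : sgraph :=
  SGraph (del_sym F) (del_irr F).

Definition independent (S : {set G}) : Prop :=
  forall x y, x \in S -> y \in S -> ~~ adj x y.

(* [partition] already asks for nonempty, pairwise disjoint, covering blocks;
   [uniq] rules out two of the listed sets being the same block. *)
Definition partition_into (s : seq {set G}) : bool :=
  uniq s && partition [set:: s] [set: G].

Definition bipartite_with (X Y : {set G}) : Prop :=
  [/\ partition_into [:: X; Y], independent X & independent Y].

Definition opposite (X Y : {set G}) (x y : G) : bool :=
  (x \in X) && (y \in Y) || (x \in Y) && (y \in X).

End InducedDeleted.

Definition complete_adj m : rel 'I_m := fun x y => x != y.

Fact complete_sym m : symmetric (@complete_adj m).
Proof. by move=> x y; rewrite /complete_adj eq_sym. Qed.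

Fact complete_irr m : irreflexive (@complete_adj m).
Proof. by move=> x; rewrite /complete_adj eqxx. Qed.

Definition complete_graph m : sgraph :=
  SGraph (@complete_sym m) (@complete_irr m).

Definition path_adj k : rel 'I_k :=
  fun x y => (y == x.+1 :> nat) || (x == y.+1 :> nat).

Fact path_sym k : symmetric (@path_adj k).
Proof. by move=> x y; rewrite /path_adj orbC. Qed.

Fact path_irr k : irreflexive (@path_adj k).
Proof. by move=> x; rewrite /path_adj orbb ltn_eqF. Qed.

Definition path_graph k : sgraph := SGraph (@path_sym k) (@path_irr k).

Definition induces_path (G : sgraph) (S : {set G}) : Prop :=
  exists2 k, 0 < k & graph_iso (induced S) (path_graph k).

(* A genuine cycle only for 3 <= k. *)
Definition cycle_adj k : rel 'I_k := fun x y =>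
  (x != y) && ((y == x.+1 %% k :> nat) || (x == y.+1 %% k :> nat)).

Fact cycle_sym k : symmetric (@cycle_adj k).
Proof. by move=> x y; rewrite /cycle_adj eq_sym orbC. Qed.

Fact cycle_irr k : irreflexive (@cycle_adj k).
Proof. by move=> x; rewrite /cycle_adj eqxx. Qed.

Definition cycle_graph k : sgraph := SGraph (@cycle_sym k) (@cycle_irr k).

Definition biclique_adj r s : rel ('I_r + 'I_s)%type := fun x y =>
  match x, y with
  | inl _, inr _ | inr _, inl _ => true
  | _, _ => false
  end.

Fact biclique_sym r s : symmetric (@biclique_adj r s).
Proof. by case=> x; case=> y. Qed.

Fact biclique_irr r s : irreflexive (@biclique_adj r s).
Proof. by case. Qed.

Definition biclique r s : sgraph :=
  SGraph (@biclique_sym r s) (@biclique_irr r s).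

(* m = p k for some integer k >= 2; for p > 0 the bound k <= m loses nothing,
   see [proper_multipleP]. *)
Definition proper_multiple (p m : nat) : bool :=
  [exists k : 'I_m.+1, (2 <= k) && (m == p * k)].

Lemma proper_multipleP p m : 0 < p ->
  reflect (exists2 k, 2 <= k & m = p * k) (proper_multiple p m).
Proof.
move=> p_gt0; apply: (iffP existsP) => [[k /andP[k2 /eqP mE]]|[k k2 mE]].
  by exists k.
have km : k < m.+1 by rewrite ltnS mE leq_pmull.
by exists (Ordinal km); rewrite /= k2 mE eqxx.
Qed.

Definition admissible (p m : nat) : bool :=
  [&& 0 < m, odd m & ~~ proper_multiple p m].

Section PrimeGraph.
Variables p n : nat.

Definition label_type := {v : 'I_(2 * n).+1 | (0 < v) && ~~ odd v}.

Definition label (v : label_type) : nat := val (val v).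

(* The labels are even, so both halvings are exact. *)
Definition Gpn_adj : rel label_type := fun a b =>
  [&& a != b, admissible p ((label a + label b) %/ 2)
    & admissible p (`|label a - label b|%N %/ 2)].

Fact Gpn_sym : symmetric Gpn_adj.
Proof. by move=> a b; rewrite /Gpn_adj eq_sym addnC distnC. Qed.

Fact Gpn_irr : irreflexive Gpn_adj.
Proof. by move=> a; rewrite /Gpn_adj eqxx. Qed.

Definition Gpn : sgraph := SGraph Gpn_sym Gpn_irr.

Definition mod4_part (r : nat) : {set Gpn} :=
  [set v : Gpn | label v == r %[mod 4]].

End PrimeGraph.

(* Main.v *)
Require Import Defs.
From HB Require Import structures.
From mathcomp Require Import all_boot all_order ssralg ssrint.
From mathcomp Require Import zify.

(** Halve the labels: vertices become [1, ..., n], and [i], [j] of opposite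
    parity are adjacent unless [i = j] or [i = - j] modulo 5, the exceptions
    being the pairs with [i + j = 5] or [|i - j| = 5], which are adjacent.
    Split the vertices according to [i = 0], [i = +-1] or [i = +-2] modulo 5.
    Two distinct classes are completely joined up to parity.  Inside the class
    of 0 the sum and the difference are both multiples of 5 and the sum is
    at least 15 when it is odd, so there is no edge.  The class of [r] or [- r]
    is the path  [..., r + 10, r + 5, r, 5 - r, 10 - r, 15 - r, ...]. *)

(** * Isomorphisms from labellings, and partitions into fibres *)

(** Two injective labellings with the same image match vertices of equal label, and both adjacencies
    are pulled back from [a]. The images are compared with [==] so that [xchoose] yields the two
    maps. *)
Lemma graph_iso_label (G H : sgraph) (T : eqType) (a : rel T)
    (l : G -> T) (e : H -> T) :
  injective l -> injective e ->
  (forall x, exists y, e y == l x) -> (forall y, exists x, l x == e y) ->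
  (forall x x', adj x x' = a (l x) (l x')) ->
  (forall y y', adj y y' = a (e y) (e y')) ->
  graph_iso G H.
Proof.
move=> l_inj e_inj lE eE adjl adje.
have fK x : e (xchoose (lE x)) = l x by apply/eqP; exact: (xchooseP (lE x)).
have gK y : l (xchoose (eE y)) = e y by apply/eqP; exact: (xchooseP (eE y)).
exists (fun x => xchoose (lE x)); split; last by move=> x y; rewrite adje !fK adjl.
exists (fun y => xchoose (eE y)) => [x|y].
  by apply: l_inj; rewrite gK fK.
by apply: e_inj; rewrite fK gK.
Qed.

(** Surjectivity of [c] onto [t] makes every block nonempty, and also keeps the blocks of distinct
    values distinct. *)
Lemma partition_into_fibers (G : sgraph) (T : eqType) (c : G -> T) (t : seq T) :
  uniq t -> (forall x, c x \in t) -> (forall i, i \in t -> exists x, c x = i) ->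
  partition_into [seq [set x | c x == i] | i <- t].
Proof.
move=> t_uniq ct onto; apply/andP; split.
  rewrite map_inj_in_uniq // => i j ti _ /setP eq_ij.
  by have [x cx] := onto i ti; move: (eq_ij x); rewrite !inE cx eqxx => /esym/eqP.
apply/and3P; split.
- apply/eqP/setP=> x; rewrite in_setT; apply/bigcupP.
  exists [set y | c y == c x]; last by rewrite inE.
  by rewrite inE; apply/mapP; exists (c x).
- apply/trivIsetP=> A B; rewrite !inE => /mapP[i _ ->] /mapP[j _ ->] neq.
  rewrite -setI_eq0; apply: contraNT neq => /set0Pn[x].
  by rewrite !inE => /andP[/eqP<- /eqP<-].
- rewrite inE; apply/mapP=> -[i ti /setP eq0]; have [x cx] := onto i ti.
  by move: (eq0 x); rewrite !inE cx eqxx.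
Qed.

(** * Halved labels and adjacency as linear arithmetic *)

Definition half_label {p n} (v : Gpn p n) : nat := label v %/ 2.

Lemma label_half p n (v : Gpn p n) : label v = 2 * half_label v.
Proof.
rewrite /half_label /label; case: v => -[m lt_m] /= /andP[_ even_m]; lia.
Qed.

Lemma half_label_bound {p n} (v : Gpn p n) : 0 < half_label v <= n.
Proof.
rewrite /half_label /label; case: v => -[m lt_m] /= /andP[m_gt0 even_m]; lia.
Qed.

Lemma half_label_inj p n : injective (@half_label p n).
Proof.
by move=> u v uv; apply/val_inj/val_inj; rewrite /= -!/(label _) !label_half uv.
Qed.

Lemma half_label_onto p n i : 0 < i <= n -> exists v : Gpn p n, half_label v = i.
Proof.
move=> i_bound; have lt_i : 2 * i < (2 * n).+1 by lia.
have P : (0 < Ordinal lt_i) && ~~ odd (Ordinal lt_i) by rewrite /=; lia.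
by exists (exist _ (Ordinal lt_i) P); rewrite /half_label /label /= mulKn.
Qed.

(** A form of [admissible 5] that [lia] can decide: a positive multiple of 5 is proper exactly when
    it is at least 10. *)
Definition adm5 (m : nat) : bool := odd m && ((m %% 5 != 0) || (m == 5)).

Lemma admissible5E m : admissible 5 m = adm5 m.
Proof.
rewrite /admissible /adm5.
have -> : proper_multiple 5 m = (m %% 5 == 0) && (10 <= m).
  apply/proper_multipleP/idP => // [[k k2 ->]|m5]; first by lia.
  by exists (m %/ 5); lia.
lia.
Qed.

(** With truncated subtraction, [(i - j) + (j - i)] is the distance between [i] and [j]. *)
Definition adj5 (i j : nat) : bool := adm5 (i + j) && adm5 ((i - j) + (j - i)).

Lemma adj_half n (u v : Gpn 5 n) :
  adj u v = adj5 (half_label u) (half_label v).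
Proof.
rewrite /= /Gpn_adj !admissible5E !label_half /adj5.
have -> : (2 * half_label u + 2 * half_label v) %/ 2
          = half_label u + half_label v by lia.
set d := _ %/ 2; have -> : d = (half_label u - half_label v)
          + (half_label v - half_label u) by rewrite /d; lia.
(* On the diagonal the difference is 0, which is even, so [adj5] is false there too. *)
by case: eqVneq => // ->; rewrite !subnn andbF.
Qed.

Lemma graph_iso_Gpn5 (H : sgraph) n (e : H -> nat) :
  injective e -> (forall y, 0 < e y <= n) ->
  (forall i, 0 < i <= n -> exists y, e y == i) ->
  (forall y y', adj y y' = adj5 (e y) (e y')) ->
  graph_iso (Gpn 5 n) H.
Proof.
move=> e_inj e_bound e_onto adje.
apply: (graph_iso_label (Gpn 5 n) H _ adj5 half_label e) => //.
- exact: half_label_inj.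
- by move=> x; apply/e_onto/half_label_bound.
- by move=> y; have [x <-] := half_label_onto 5 _ _ (e_bound y); exists x.
- exact: adj_half.
Qed.

(** * Partite sets, classes modulo 5 and the decomposition *)

Lemma mod4_half p n r (v : Gpn p n) : r < 2 ->
  (v \in mod4_part p n (2 * r)) = (half_label v %% 2 == r).
Proof. by move=> r2; rewrite inE label_half; lia. Qed.

(* The distance from [i] to the nearest multiple of 5. *)
Definition class5 (i : nat) : nat := minn (i %% 5) (5 - i %% 5).

Lemma class5_le2 i : class5 i <= 2. Proof. rewrite /class5; lia. Qed.

Lemma adj5_odd i j : adj5 i j -> i %% 2 != j %% 2.
Proof. rewrite /adj5 /adm5; lia. Qed.

(** Positivity matters: 0 and 5 have sum and difference 5, so [adj5 0 5] holds. *)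
Lemma adj5_class0 i j : 0 < i -> 0 < j ->
  class5 i = 0 -> class5 j = 0 -> adj5 i j = false.
Proof. rewrite /adj5 /adm5 /class5; lia. Qed.

(** Neither the sum nor the difference is divisible by 5, and opposite parity makes both odd. *)
Lemma adj5_neq_class i j :
  class5 i != class5 j -> i %% 2 != j %% 2 -> adj5 i j.
Proof. rewrite /adj5 /adm5 /class5; lia. Qed.

(** As [2 * i] is not divisible by 5, exactly one of the sum and the difference is a multiple of 5.
    It must equal 5, and the other is then odd as well. *)
Lemma adj5_same_class r i j : 0 < r -> 0 < i -> 0 < j ->
    class5 i = r -> class5 j = r ->
  adj5 i j = [|| i + j == 5, i == j + 5 | j == i + 5].
Proof. rewrite /adj5 /adm5 /class5; lia. Qed.

(* Position [k] on the path of the class [r], whose first [A] vertices are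
   the numbers congruent to [r], in decreasing order. *)
Definition path_label (r A k : nat) : nat :=
  if k < A then r + 5 * (A.-1 - k) else 5 - r + 5 * (k - A).

(** Successive values of [path_label] differ by 5, except at the junction, where [r] and [5 - r]
    have sum 5. *)
Lemma induces_path_class n r : 0 < r <= 2 -> 2 <= n ->
  induces_path [set v : Gpn 5 n | class5 (half_label v) == r].
Proof.
(* [A] and [B] count the numbers in [1, ..., n] congruent to [r] and to [- r]. Since [r <= 2 <= n],
   the subtraction is exact. *)
move=> r12 n2; pose A := ((n - r) %/ 5).+1; pose B := (n + r) %/ 5.
exists (A + B) => //.
have e_bound (k : 'I_(A + B)) : 0 < path_label r A k <= n.
  have := ltn_ord k; rewrite /path_label /A /B; case: ifP; lia.
have e_class k : class5 (path_label r A k) = r.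
  rewrite /path_label /class5; case: ifP; lia.
set S := [set v | _].
apply: (graph_iso_label (induced S) (path_graph (A + B)) _ adj5
          (fun v : induced S => half_label (val v)) (path_label r A)).
- by move=> u v /half_label_inj/val_inj.
- move=> k k' /=; rewrite /path_label => eq_kk'; apply: val_inj => /=.
  by move: eq_kk'; case: ifP; case: ifP; lia.
- case=> v /=; rewrite inE => /eqP vr; have := half_label_bound v.
  move: (half_label v) vr => i; rewrite /class5 => ir i_bound.
  (* The inverse of [path_label]: [i] is [r + 5 * q] or [5 - r + 5 * q] with [q = i %/ 5]. *)
  pose k := if i %% 5 == r then A.-1 - i %/ 5 else A + i %/ 5.
  have lt_k : k < A + B by rewrite /k /A /B; case: ifP; lia.
  exists (Ordinal lt_k); rewrite /= /path_label /k /A.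
  by case: ifP; case: ifP; lia.
- move=> k; have [v vE] := half_label_onto 5 _ _ (e_bound k).
  have vS : v \in S by rewrite inE vE e_class.
  by exists (exist _ v vS); rewrite /= vE.
- by move=> u v; rewrite -adj_half.
- move=> k k'; have /andP[k_gt0 _] := e_bound k; have /andP[k'_gt0 _] := e_bound k'.
  rewrite (adj5_same_class r) ?e_class //; last by case/andP: r12.
  by rewrite /= /path_adj /path_label; case: ifP; case: ifP; lia.
Qed.

Lemma Gpn5_decomposition n : 10 <= n ->
  let G := Gpn 5 n in
  let X : {set G} := mod4_part 5 n 0 in
  let Y : {set G} := mod4_part 5 n 2 in
  bipartite_with X Y /\
  exists I Q1 Q2 : {set G},
    [/\ partition_into [:: I; Q1; Q2],
        independent I,
        induces_path Q1 /\ induces_path Q2,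
        (forall u v : G, u \in Q1 -> v \in I :|: Q2 ->
           opposite X Y u v -> adj u v) /\
        (forall u v : G, u \in Q2 -> v \in I :|: Q1 ->
           opposite X Y u v -> adj u v)
      & forall e : {set G}, e \in edge_set G ->
          exists u v : G, e = [set u; v] /\
            [\/ [/\ u \in Q1, v \in I :|: Q2 & opposite X Y u v],
                [/\ u \in Q2, v \in I :|: Q1 & opposite X Y u v],
                u \in Q1 /\ v \in Q1
              | u \in Q2 /\ v \in Q2]].
Proof.
move=> n10 G X Y.
have XE v : (v \in X) = (half_label v %% 2 == 0) by exact: (mod4_half _ _ 0).
have YE v : (v \in Y) = (half_label v %% 2 == 1) by exact: (mod4_half _ _ 1).
have oppE u v : opposite X Y u v = (half_label u %% 2 != half_label v %% 2).
  by rewrite /opposite !XE !YE; lia.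
split.
  split.
  - apply: (@partition_into_fibers G _ (fun v => label v %% 4) [:: 0; 2]) => //.
      by move=> v; rewrite !inE label_half; lia.
    move=> i; rewrite !inE => i02.
    (* The witnesses are the labels 4 for residue 0 and 2 for residue 2. *)
    have i_bound : 0 < 2 - i %/ 2 <= n by lia.
    have [v vE] := half_label_onto 5 n _ i_bound.
    by exists v; rewrite label_half vE; lia.
  - move=> u v; rewrite !XE adj_half => /eqP u0 /eqP v0.
    by apply/negP => /adj5_odd; rewrite u0 v0.
  - move=> u v; rewrite !YE adj_half => /eqP u0 /eqP v0.
    by apply/negP => /adj5_odd; rewrite u0 v0.
pose Q r : {set G} := [set v | class5 (half_label v) == r].
have QE r v : (v \in Q r) = (class5 (half_label v) == r) by rewrite inE.
have adjQ r s t u v : r != s -> r != t ->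
    u \in Q r -> v \in Q s :|: Q t -> opposite X Y u v -> adj u v.
  move=> rs rt; rewrite in_setU !QE oppE adj_half => /eqP ur vst.
  by apply: adj5_neq_class; rewrite ur; case/orP: vst => /eqP->.
exists (Q 0), (Q 1), (Q 2); split.
- apply: (@partition_into_fibers G _ (class5 \o half_label) [:: 0; 1; 2]) => //.
    by move=> v; have := class5_le2 (half_label v); rewrite !inE /=; lia.
  move=> i; rewrite !inE => i012.
  (* The numbers 5, 6, 7 represent the classes 0, 1, 2. *)
  have i_bound : 0 < 5 + i <= n by lia.
  have [v vE] := half_label_onto 5 n _ i_bound.
  by exists v; rewrite /= vE /class5; lia.
- move=> u v; rewrite !QE adj_half => /eqP u0 /eqP v0.
  have /andP[u_gt0 _] := half_label_bound u.
  by have /andP[v_gt0 _] := half_label_bound v; rewrite adj5_class0.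
- by split; apply: induces_path_class => //; lia.
- by split=> u v; apply: adjQ.
move=> e; rewrite inE => /existsP[u /existsP[v /andP[uv /eqP->]]].
have opp_uv : opposite X Y u v by rewrite oppE adj5_odd // -adj_half.
have opp_vu : opposite X Y v u by rewrite oppE eq_sym -oppE.
have := class5_le2 (half_label u); have := class5_le2 (half_label v).
(* Of the nine pairs of classes, [(0, 0)] carries no edge. If only [u] has class 0, the ends are
   swapped so that the path vertex comes first. *)
case cu: (class5 (half_label u)) => [|[|[|?]]] //;
  case cv: (class5 (half_label v)) => [|[|[|?]]] // _ _.
- move: uv; rewrite adj_half adj5_class0 //.
    by case/andP: (half_label_bound u).
  by case/andP: (half_label_bound v).
- by exists v, u; rewrite setUC !in_setU !QE cu cv; split=> //; constructor 1.
- by exists v, u; rewrite setUC !in_setU !QE cu cv; split=> //; constructor 2.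
- by exists u, v; rewrite !in_setU !QE cu cv; split=> //; constructor 1.
- by exists u, v; rewrite !in_setU !QE cu cv; split=> //; constructor 3.
- by exists u, v; rewrite !in_setU !QE cu cv; split=> //; constructor 1.
- by exists u, v; rewrite !in_setU !QE cu cv; split=> //; constructor 2.
- by exists u, v; rewrite !in_setU !QE cu cv; split=> //; constructor 2.
- by exists u, v; rewrite !in_setU !QE cu cv; split=> //; constructor 4.
Qed.

(** * The cases of at most nine vertices *)

(** Even numbers go left and odd ones right, so sides of sizes [n./2] and [uphalf n] use up
    [1, ..., n]. *)
Definition biclique_label {r s} (x : biclique r s) : nat :=
  match x with inl i => 2 * i + 2 | inr j => 2 * j + 1 end.

Lemma biclique_label_inj r s : injective (@biclique_label r s).
Proof.
case=> [i|i] [j|j] /= ij; try lia.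
  by congr inl; apply: val_inj => /=; lia.
by congr inr; apply: val_inj => /=; lia.
Qed.

Lemma biclique_label_bound n (x : biclique n./2 (uphalf n)) :
  0 < biclique_label x <= n.
Proof. case: x => i /=; have := ltn_ord i; lia. Qed.

Lemma biclique_label_onto n i : 0 < i <= n ->
  exists x : biclique n./2 (uphalf n), biclique_label x == i.
Proof.
move=> i_bound; case: (boolP (odd i)) => odd_i.
  have lt_i : i./2 < uphalf n by lia.
  by exists (inr (Ordinal lt_i)); rewrite /=; lia.
have lt_i : i./2.-1 < n./2 by lia.
by exists (inl (Ordinal lt_i)); rewrite /=; lia.
Qed.

(** Odd sums are at most 13 and differences at most 6, so 5 is the only odd multiple of 5 that
    occurs, and all pairs of opposite parity are adjacent. *)
Lemma graph_iso_biclique n : n <= 7 ->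
  graph_iso (Gpn 5 n) (biclique n./2 (uphalf n)).
Proof.
move=> n7; apply: (graph_iso_Gpn5 _ _ biclique_label).
- exact: biclique_label_inj.
- exact: biclique_label_bound.
- exact: biclique_label_onto.
- by case=> [i|i] [j|j] /=; have := ltn_ord i; have := ltn_ord j;
    rewrite /adj5 /adm5; lia.
Qed.

Lemma eq_biclique_edge r s (i a : 'I_r) (j b : 'I_s) :
  ([set inl i; inr j] == [set inl a; inr b] :> {set biclique r s})
  = (i == a) && (j == b).
Proof.
apply/eqP/andP => [/setP E|[/eqP-> /eqP->]] //.
move: (E (inl i)) (E (inr j)); rewrite !inE !eqxx /= orbF.
by move=> /esym/eqP[->] /esym/eqP[->].
Qed.

Lemma biclique_edge r s (a : 'I_r) (b : 'I_s) :
  [set inl a; inr b] \in edge_set (biclique r s).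
Proof.
by rewrite inE; apply/existsP; exists (inl a); apply/existsP; exists (inr b) => /=.
Qed.

Lemma graph_iso_del_biclique n (F : {set {set biclique n./2 (uphalf n)}}) :
  (forall (i : 'I_n./2) (j : 'I_(uphalf n)),
     ([set inl i; inr j] \notin F) = adj5 (2 * i + 2) (2 * j + 1)) ->
  graph_iso (Gpn 5 n) (del_edges F).
Proof.
move=> FE; apply: (graph_iso_Gpn5 (del_edges F) _ biclique_label).
- exact: biclique_label_inj.
- exact: biclique_label_bound.
- exact: biclique_label_onto.
- case=> [i|i] [j|j]; rewrite /= /del_adj /=.
  + by rewrite /adj5 /adm5; lia.
  + exact: FE.
  + by rewrite setUC FE /adj5 addnC [X in _ && adm5 X]addnC.
  + by rewrite /adj5 /adm5; lia.
Qed.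

Theorem theorem5p2 :
  (forall n : nat, 10 <= n ->
     let G := Gpn 5 n in
     let X : {set G} := mod4_part 5 n 0 in
     let Y : {set G} := mod4_part 5 n 2 in
     bipartite_with X Y /\
     exists I Q1 Q2 : {set G},
       [/\ partition_into [:: I; Q1; Q2],
           independent I,
           induces_path Q1 /\ induces_path Q2,
           (forall u v : G, u \in Q1 -> v \in I :|: Q2 ->
              opposite X Y u v -> adj u v) /\
           (forall u v : G, u \in Q2 -> v \in I :|: Q1 ->
              opposite X Y u v -> adj u v)
         & forall e : {set G}, e \in edge_set G ->
             exists u v : G, e = [set u; v] /\
               [\/ [/\ u \in Q1, v \in I :|: Q2 & opposite X Y u v],
                   [/\ u \in Q2, v \in I :|: Q1 & opposite X Y u v],
                   u \in Q1 /\ v \in Q1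
                 | u \in Q2 /\ v \in Q2]]) /\
  graph_iso (Gpn 5 1) (complete_graph 1) /\
  graph_iso (Gpn 5 2) (complete_graph 2) /\
  graph_iso (Gpn 5 3) (path_graph 3) /\
  graph_iso (Gpn 5 4) (cycle_graph 4) /\
  graph_iso (Gpn 5 5) (biclique 2 3) /\
  graph_iso (Gpn 5 6) (biclique 3 3) /\
  graph_iso (Gpn 5 7) (biclique 3 4) /\
  (exists2 e : {set biclique 4 4}, e \in edge_set (biclique 4 4) &
     graph_iso (Gpn 5 8) (del_edges [set e])) /\
  (exists e1 e2 : {set biclique 4 5},
     [/\ e1 \in edge_set (biclique 4 5),
         e2 \in edge_set (biclique 4 5),
         [disjoint e1 & e2]
       & graph_iso (Gpn 5 9) (del_edges [set e1; e2])]).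
Proof.
split; first exact: Gpn5_decomposition.
(* For [n <= 4], consecutive numbers are adjacent, and 1 and 4, with sum 5 and difference 3, close
   the 4-cycle. *)
have iso_ord n (H : rel 'I_n) Hs Hi :
    (forall i j, H i j = adj5 i.+1 j.+1) -> graph_iso (Gpn 5 n) (@SGraph _ H Hs Hi).
  move=> HE; apply: (graph_iso_Gpn5 (SGraph Hs Hi) _ (fun i : 'I_n => i.+1)) => //.
  - by move=> i j [/val_inj].
  - by move=> i; rewrite ltn_ord.
  - by case=> // i lt_i; exists (Ordinal lt_i).
split; first by apply: iso_ord => -[[|?] ?] [[|?] ?].
split; first by apply: iso_ord => -[[|[|?]] ?] [[|[|?]] ?].
split; first by apply: iso_ord => -[[|[|[|?]]] ?] [[|[|[|?]]] ?].
split; first by apply: iso_ord => -[[|[|[|[|?]]]] ?] [[|[|[|[|?]]]] ?].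
split; first exact: (graph_iso_biclique 5).
split; first exact: (graph_iso_biclique 6).
split; first exact: (graph_iso_biclique 7).
split.
  (* These vertices are labelled 8 and 7, the only pair up to 8 with sum 15. *)
  exists [set inl (@Ordinal 4 3 isT); inr (@Ordinal 4 3 isT)].
    exact: biclique_edge.
  apply: (graph_iso_del_biclique 8) => i j.
  rewrite inE eq_biclique_edge -!val_eqE /= /adj5 /adm5.
  have := ltn_ord i; have := ltn_ord j; rewrite /=; lia.
(* Up to 9, the sum 15 arises as [8 + 7] and as [6 + 9], which gives the two deleted edges. *)
exists [set inl (@Ordinal 4 3 isT); inr (@Ordinal 5 3 isT)].
exists [set inl (@Ordinal 4 2 isT); inr (@Ordinal 5 4 isT)].
split; [exact: biclique_edge|exact: biclique_edge| |].
  apply/pred0P => x; rewrite /= !inE.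
  by case: x => x; apply/negP => /andP[] /orP[] // /eqP[->].
apply: (graph_iso_del_biclique 9) => i j.
rewrite !inE !eq_biclique_edge -!val_eqE /= /adj5 /adm5.
have := ltn_ord i; have := ltn_ord j; rewrite /=; lia.
Qed.
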